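(* Let $B$ be a real-valued function of $CZ$ with $1-\mathbb{E}_\nu(B(CZ))\ge\max_{dz}\nu(d|z)$ for all $\nu\in\mathcal{C}_{C|Z}\rtimes\mathrm{Unif}_Z$, let $\rho_{C|Z}\in\mathcal{C}_{C|Z}$ with $\bar b=\mathbb{E}_{\rho_{C|Z}\rtimes\mathrm{Unif}_Z}(B)>0$, and let $F_{r,\beta}$ be the associated family of functions of $CZT$ defined in the context. Consider $n$ trials with model $\mathcal{H}(\mathcal{C}_{C|ZT}\rtimes\nu_r)$ and a fixed error bound $\epsilon_h\in(0,1]$. Let $g_{r,\beta}=\mathbb{E}_{\tilde\rho_{C|ZT}\rtimes\nu_r}(\log F_{r,\beta})/\beta$ be the log-prob rate of $F_{r,\beta}$ at $\tilde\rho_{C|ZT}\rtimes\nu_r$, and assume that the trials are i.i.d. for $CZT$ with this distribution. Then we can choose $r=r_n$ and $\beta=\beta_n$ as functions of $n$ (with $F_{r_n,\beta_n}$ a PEF with power $\beta_n$ for $\mathcal{C}_{C|ZT}\rtimes\nu_{r_n}$) so that, for all sufficiently large $n$, the expected net log-prob satisfies $$g_{\mathrm{net}}=n\,g_{r_n,\beta_n}-\log(1/\epsilon_h)/\beta_n\ \ge\ n(-\log(1-\bar b))/3\;=\;e^{\Omega(nS(\nu_{r_n}))},$$ where $nS(\nu_{r_n})$ is the total input entropy of the settings sequence $\mathbf{Z}\mathbf{T}$; that is, there is a constant $a>0$ such that $n(-\log(1-\bar b))/3\ge e^{a\,nS(\nu_{r_n})}$ for all sufficiently large $n$.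
   Context: All random variables have finite value spaces; $\mathrm{Rng}(X)$ is the value space of $X$, $\mathrm{Unif}_Z$ the uniform distribution on $\mathrm{Rng}(Z)$. $D$ is a function of $C$. Logarithms and entropies are natural (base $e$); expectations and maxima of conditional probabilities only involve values/conditioners of positive probability. $\mathcal{C}_{C|Z}$ is a fixed closed convex set of families $(\rho_{C|z})_{z\in\mathrm{Rng}(Z)}$ of distributions of $C$. For such a family $\rho_{C|Z}$ and a distribution $\nu$ of $Z$, $(\rho_{C|Z}\rtimes\nu)(cz)=\rho_{C|z}(c)\nu(z)$; $\mathcal{C}_{C|Z}\rtimes\nu=\{\rho_{C|Z}\rtimes\nu:\rho_{C|Z}\in\mathcal{C}_{C|Z}\}$. $T\in\{0,1\}$ is a test bit appended to the settings $Z$. For $\rho_{C|Z}\in\mathcal{C}_{C|Z}$ let $\tilde\rho_{C|zt}=\rho_{C|z}$ for all $z,t$, and $\mathcal{C}_{C|ZT}=\{\tilde\rho_{C|ZT}:\rho_{C|Z}\in\mathcal{C}_{C|Z}\}$; $\rtimes$ is used analogously for $ZT$. Let $q=1/|\mathrm{Rng}(Z)|$ and fix a value $z_0$ of $Z$. For $0<r<1/2$, $\nu_r$ is the distribution of $ZT$ with $\nu_r(z1)=rq$ and $\nu_r(z0)=(1-r)$ if $z=z_0$, $0$ otherwise. Its entropy is $S(\nu_r)=-r\log r-(1-r)\log(1-r)+r\log(1/q)$. Define $B_r(CZ0)=0$, $B_r(CZ1)=B(CZ)/r$, and for $\beta>0$ $$F_{r,\beta}(CZT)=(1-\bar b)^{-\beta}\left(1+\beta\frac{B_r(CZT)-\bar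 b}{1-\bar b}\right).$$ PEF: a probability estimation factor with power $\beta>0$ for a set $\mathcal{C}$ of distributions of $CZT$ (and $D|ZT$) is a non-negative function $F(CZT)$ with $\mathbb{E}_\sigma(F(CZT)\sigma(D|ZT)^\beta)\le1$ for all $\sigma\in\mathcal{C}$. For PEFs $F_i$ with power $\beta$ used in trials $i=1,\dots,n$ with outcomes $c_i$ and settings $z_it_i$, the net log-prob with error bound $\epsilon_h$ is $\sum_i\log(F_i(c_iz_it_i))/\beta-\log(1/\epsilon_h)/\beta$. $\mathcal{H}(\mathcal{C})$ denotes the model of $n$ trials in which each trial's distribution conditional on the past is in $\mathcal{C}$ and each trial's settings are independent of past outcomes given past settings; an external RV $E$ is suppressed by conditioning on its value. *)

(* Defs.v *)
(* Classical analysis over an arbitrary [R : realType] (MathComp-Analysis).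
   Random variables have finite value spaces, which are finTypes; a distribution
   on [T : finType] is a weight function [T -> R]. *)
From HB Require Import structures.
From mathcomp Require Import all_boot all_order all_algebra.
From mathcomp Require Import all_classical all_reals all_analysis.

Set Implicit Arguments.
Unset Strict Implicit.
Unset Printing Implicit Defensive.

Import Order.TTheory GRing.Theory Num.Theory.
Import numFieldNormedType.Exports.
Local Open Scope classical_set_scope.
Local Open Scope ring_scope.

Definition is_dist (R : realType) (T : finType) (p : T -> R) : Prop :=
  (forall x, 0 <= p x) /\ \sum_x p x = 1.

Definition expect (R : realType) (T : finType) (p f : T -> R) : R :=
  \sum_x p x * f x.

Definition prob (R : realType) (T : finType) (p : T -> R) (E : pred T) : R :=
  \sum_(x | E x) p x.

(* [ln 0 = 0] in the library, so that [0 log 0 = 0]. *)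
Definition entropy (R : realType) (T : finType) (p : T -> R) : R :=
  - \sum_x p x * ln (p x).

Definition uniform_dist (R : realType) (S : finType) : S -> R :=
  fun=> #|S|%:R^-1.

(* Below, [C] is the outcome space of a trial, [S] its settings space ([S] will
   be [Z] or [Z * bool]), and the outcome function [D] is given by [dof : C -> D].
   A family (rho_{C|s})_s is represented by [rho : S -> C -> R]. *)

Definition is_family (R : realType) (C S : finType) (rho : S -> C -> R) : Prop :=
  forall s, is_dist (rho s).

Definition rtimes (R : realType) (C S : finType)
    (rho : S -> C -> R) (nu : S -> R) : C * S -> R :=
  fun cs => rho cs.2 cs.1 * nu cs.2.

Definition rtimes_set (R : realType) (C S : finType)
    (A : set (S -> C -> R)) (nu : S -> R) : set (C * S -> R) :=
  [set rtimes rho nu | rho in A].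

Definition probDS (R : realType) (C D S : finType) (dof : C -> D)
    (sigma : C * S -> R) (d : D) (s : S) : R :=
  prob sigma (fun cs => (dof cs.1 == d) && (cs.2 == s)).

(* sigma(d|s); it is only meaningful when sigma(s) > 0. *)
Definition condD (R : realType) (C D S : finType) (dof : C -> D)
    (sigma : C * S -> R) (d : D) (s : S) : R :=
  probDS dof sigma d s / prob sigma (fun cs => cs.2 == s).

(* The maximum runs over the pairs of positive probability; the conditional
   probabilities are positive there, so the default value 0 is harmless. *)
Definition max_condD (R : realType) (C D S : finType) (dof : C -> D)
    (sigma : C * S -> R) : R :=
  \big[Num.max/0]_(ds : D * S | 0 < probDS dof sigma ds.1 ds.2)
    condD dof sigma ds.1 ds.2.

(* Where sigma(s) = 0 the junk value of [condD] is multiplied by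
   sigma(cs) = 0 in the expectation. *)
Definition is_PEF (R : realType) (C D S : finType) (dof : C -> D)
    (beta : R) (A : set (C * S -> R)) (F : C * S -> R) : Prop :=
  [/\ 0 < beta,
      forall cs, 0 <= F cs &
      forall sigma, A sigma ->
        expect sigma (fun cs => F cs * condD dof sigma (dof cs.1) cs.2 `^ beta)
        <= 1].

(* The test bit T is the boolean component of the settings [Z * bool]. *)

Definition lift_test (R : realType) (C Z : finType) (rho : Z -> C -> R) :
    Z * bool -> C -> R :=
  fun zt => rho zt.1.

Definition lift_test_set (R : realType) (C Z : finType)
    (A : set (Z -> C -> R)) : set (Z * bool -> C -> R) :=
  [set lift_test rho | rho in A].

Definition nu_test (R : realType) (Z : finType) (z0 : Z) (r : R) :
    Z * bool -> R :=
  fun zt => if zt.2 then r * #|Z|%:R^-1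
            else if zt.1 == z0 then 1 - r else 0.

Definition B_test (R : realType) (C Z : finType) (B : C * Z -> R) (r : R) :
    C * (Z * bool) -> R :=
  fun czt => if czt.2.2 then B (czt.1, czt.2.1) / r else 0.

Definition F_test (R : realType) (C Z : finType) (B : C * Z -> R)
    (bbar r beta : R) : C * (Z * bool) -> R :=
  fun czt => (1 - bbar) `^ (- beta) *
             (1 + beta * ((B_test B r czt - bbar) / (1 - bbar))).

Definition logprob_rate (R : realType) (T : finType)
    (sigma F : T -> R) (beta : R) : R :=
  expect sigma (fun x => ln (F x)) / beta.

(* Sequences of [n] trials: elements of [{ffun 'I_n -> C * S}]. *)

Definition same_past (n : nat) (T : finType) (i : 'I_n)
    (x y : {ffun 'I_n -> T}) : bool :=
  [forall j : 'I_n, (j < i)%N ==> (y j == x j)].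

Definition same_past_settings (n : nat) (C S : finType) (i : 'I_n)
    (x y : {ffun 'I_n -> C * S}) : bool :=
  [forall j : 'I_n, (j < i)%N ==> ((y j).2 == (x j).2)].

(* The distribution of trial [i] given the past of the trajectory [x]. *)
Definition cond_trial (R : realType) (n : nat) (T : finType)
    (mu : {ffun 'I_n -> T} -> R) (i : 'I_n) (x : {ffun 'I_n -> T}) : T -> R :=
  fun w => prob mu (fun y => same_past i x y && (y i == w))
           / prob mu (same_past i x).

(* The model H(A).  The last clause is the conditional independence of the
   settings of trial [i] and the past outcomes given the past settings. *)
Definition trials_model (R : realType) (n : nat) (C S : finType)
    (A : set (C * S -> R)) (mu : {ffun 'I_n -> C * S} -> R) : Prop :=
  [/\ is_dist mu,
      forall (i : 'I_n) x, 0 < prob mu (same_past i x) ->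
        A (cond_trial mu i x) &
      forall (i : 'I_n) x s, 0 < prob mu (same_past i x) ->
        prob mu (fun y => same_past i x y && ((y i).2 == s))
          / prob mu (same_past i x) =
        prob mu (fun y => same_past_settings i x y && ((y i).2 == s))
          / prob mu (same_past_settings i x)].

Definition iid_trials (R : realType) (n : nat) (T : finType)
    (sigma : T -> R) (mu : {ffun 'I_n -> T} -> R) : Prop :=
  forall x, mu x = \prod_(i < n) sigma (x i).

Definition settings_dist (R : realType) (n : nat) (C S : finType)
    (mu : {ffun 'I_n -> C * S} -> R) : {ffun 'I_n -> S} -> R :=
  fun s => prob mu (fun x => [forall i, (x i).2 == s i]).

Definition net_logprob (R : realType) (n : nat) (T : finType)
    (F : 'I_n -> T -> R) (beta epsh : R) (x : {ffun 'I_n -> T}) : R :=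
  \sum_(i < n) ln (F i (x i)) / beta - ln (epsh^-1) / beta.

Definition pointwise_closed (R : realType) (C S : finType)
    (A : set (S -> C -> R)) : Prop :=
  closed (A : set {ptws S -> {ptws C -> R}}).

(* Main.v *)
(* Take beta = c * r with a constant c and write F = (1 - bbar)^(-beta) (1 + y),
   where y = beta (B_r - bbar) / (1 - bbar) has mean 0, is O(c) when T = 1 and
   O(c r) when T = 0.  As T = 1 has probability r, E(y^2) = O(c^2 r), so that
   ln (1 + y) >= y - 2 y^2 gives a rate at least - ln (1 - bbar) - O(c), uniformly
   in r.  The error term ln (1 / epsh) / beta is then affordable for r = A / n,
   and for this choice the input entropy is A ln n + O(1).  The PEF property
   reduces to (1 - x)^beta (1 + beta x) <= 1, with 1 - x = (1 - b) / (1 - bbar)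
   and b the mean of B at the distribution under test. *)
Require Import Defs.
From HB Require Import structures.
From mathcomp Require Import all_boot all_order all_algebra.
From mathcomp Require Import all_classical all_reals all_analysis.
From mathcomp Require Import ring lra.

Set Implicit Arguments.
Unset Strict Implicit.
Unset Printing Implicit Defensive.

Import Order.TTheory GRing.Theory Num.Theory.
Import numFieldNormedType.Exports.
Local Open Scope classical_set_scope.
Local Open Scope ring_scope.

(** * Logarithms and expectations over finite distributions *)

Lemma ln_prod (R : realType) (I : finType) (f : I -> R) :
  (forall i, 0 < f i) -> ln (\prod_i f i) = \sum_i ln (f i).
Proof.
move=> f0; suff [] : 0 < \prod_i f i /\ ln (\prod_i f i) = \sum_i ln (f i) by [].
apply: (big_rec2 (fun x y => 0 < x /\ ln x = y)); first by rewrite ln1.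
by move=> i x y _ [x0 <-]; rewrite mulr_gt0// lnM// posrE.
Qed.

(** Applying ln u <= u - 1 at u = 1 / (1 + y) gives ln (1 + y) >= 1 - 1 / (1 + y). This exceeds y -
    2 y^2 by y^2 (1 + 2 y) / (1 + y), whose sign is where y >= -1/2 enters. *)
Lemma le_lnB (R : realType) (y : R) :
  - (1 / 2) <= y -> y - 2 * y ^+ 2 <= ln (1 + y).
Proof.
move=> hy; have y1 : 0 < 1 + y by lra.
have /le_ln1Dx : -1 < (1 + y)^-1 - 1 by rewrite ltrBrDr addrC subrr invr_gt0.
rewrite [1 + _]addrC subrK lnV ?posrE// lerNl opprB; apply: le_trans.
rewrite -subr_ge0.
have -> : 1 - (1 + y)^-1 - (y - 2 * y ^+ 2) = y ^+ 2 * (1 + 2 * y) / (1 + y).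
  by field; rewrite gt_eqF.
by rewrite divr_ge0 ?(ltW y1)// mulr_ge0 ?sqr_ge0//; lra.
Qed.

Lemma is_dist_exists_gt0 (R : realType) (T : finType) (p : T -> R) :
  is_dist p -> exists x, 0 < p x.
Proof.
move=> [p0 p1]; apply/existsP; apply: contraT; rewrite negb_exists => /forallP h.
have := p1; rewrite big1 => [/esym/eqP|x _]; first by rewrite oner_eq0.
by apply/le_anti; rewrite p0 andbT leNgt.
Qed.

Lemma expectZ (R : realType) (T : finType) (p f : T -> R) k :
  expect p (fun x => k * f x) = k * expect p f.
Proof. by rewrite /expect mulr_sumr; apply: eq_bigr => x _; rewrite mulrCA. Qed.

Lemma expectD (R : realType) (T : finType) (p f g : T -> R) :
  expect p (fun x => f x + g x) = expect p f + expect p g.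
Proof. by rewrite /expect -big_split; apply: eq_bigr => x _; rewrite mulrDr. Qed.

Lemma expect_cst (R : realType) (T : finType) (p : T -> R) k :
  is_dist p -> expect p (fun=> k) = k.
Proof. by move=> [_ p1]; rewrite /expect -mulr_suml p1 mul1r. Qed.

Lemma expect_sum (R : realType) (T I : finType) (p : T -> R) (f : I -> T -> R) :
  expect p (fun x => \sum_i f i x) = \sum_i expect p (f i).
Proof.
by rewrite /expect exchange_big; apply: eq_bigr => x _; rewrite mulr_sumr.
Qed.

Lemma ler_expect (R : realType) (T : finType) (p f g : T -> R) :
  (forall x, 0 <= p x) -> (forall x, 0 < p x -> f x <= g x) ->
  expect p f <= expect p g.
Proof.
move=> p0 fg; apply: ler_sum => x _; have := p0 x; rewrite le_eqVlt.
by case/predU1P => [<-|px]; rewrite ?mul0r ?ler_wpM2l ?fg// ltW.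
Qed.

(** * Independent, identically distributed trials *)

Lemma expect_iid (R : realType) (n : nat) (T : finType) (p f : T -> R)
    (mu : {ffun 'I_n -> T} -> R) (i : 'I_n) :
  is_dist p -> iid_trials p mu -> expect mu (fun x => f (x i)) = expect p f.
Proof.
move=> [_ p1] muE.
(* Padding [f (x i)] with factors 1 at the other trials turns the summand into a product over
   trials, so that the sum distributes into one-trial sums, all equal to 1 except the [i]-th. *)
transitivity (\sum_(x : {ffun 'I_n -> T})
    \prod_j (p (x j) * (if j == i then f (x j) else 1))).
  apply: eq_bigr => x _; rewrite muE big_split/=; congr (_ * _).
  by rewrite -big_mkcond/= big_pred1_eq.
rewrite -(bigA_distr_bigA (fun j t => p t * (if j == i then f t else 1))).
rewrite (bigD1 i)//= [X in _ * X]big1 ?mulr1; last first.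
  move=> j ji; rewrite -[RHS]p1.
  by apply: eq_bigr => t _; rewrite (negbTE ji) mulr1.
by apply: eq_bigr => t _; rewrite eqxx.
Qed.

Lemma entropy_iid (R : realType) (n : nat) (T : finType) (p : T -> R)
    (mu : {ffun 'I_n -> T} -> R) :
  is_dist p -> iid_trials p mu -> entropy mu = n%:R * entropy p.
Proof.
move=> pdist muE; rewrite /entropy mulrN; congr (- _).
transitivity (expect mu (fun x => \sum_i ln (p (x i)))).
  apply: eq_bigr => x _; rewrite muE.
  have [/forallP h|] := boolP [forall i, 0 < p (x i)]; first by rewrite ln_prod.
  (* If some factor vanishes, the logarithm need not split over the product, but both sides carry
     the weight 0. *)
  rewrite negb_forall => /existsP[i]; rewrite -leNgt => pi.
  have pi0 : p (x i) = 0 by apply/le_anti; rewrite pi (pdist.1 _).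
  by rewrite (bigD1 i)//= pi0 !mul0r.
rewrite expect_sum.
under eq_bigr do rewrite (expect_iid (fun t => ln (p t)) _ pdist muE).
by rewrite sumr_const card_ord mulr_natl.
Qed.

(** * Joint distributions of outcomes and settings, and their conditional probabilities *)

Lemma expect_rtimes (R : realType) (C S : finType) (rho : S -> C -> R)
    (nu : S -> R) (f : C * S -> R) :
  expect (rtimes rho nu) f = \sum_s nu s * \sum_c rho s c * f (c, s).
Proof.
under [RHS]eq_bigr do rewrite mulr_sumr.
rewrite exchange_big pair_big/=; apply: eq_bigr => -[c s] _ /=.
by rewrite /rtimes/= mulrA [rho s c * _]mulrC.
Qed.

Lemma prob_rtimes (R : realType) (C S : finType) (rho : S -> C -> R)
    (nu : S -> R) (E : pred C) s :
  prob (rtimes rho nu) (fun cs => E cs.1 && (cs.2 == s)) =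
  nu s * \sum_(c | E c) rho s c.
Proof.
rewrite /prob (reindex_onto (fun c => (c, s)) fst) /=; last first.
  by move=> [c t] /= /andP[_ /eqP->].
rewrite mulr_sumr; apply: eq_big => [c|c _]; first by rewrite !eqxx !andbT.
by rewrite mulrC.
Qed.

Lemma is_dist_rtimes (R : realType) (C S : finType) (rho : S -> C -> R)
    (nu : S -> R) :
  is_family rho -> is_dist nu -> is_dist (rtimes rho nu).
Proof.
move=> rhof [nu0 nu1]; split => [[c s]|].
  by rewrite mulr_ge0//=; case: (rhof s) => + _; apply.
transitivity (expect (rtimes rho nu) (fun=> 1)).
  by apply: eq_bigr => cs _; rewrite mulr1.
rewrite expect_rtimes -[RHS]nu1; apply: eq_bigr => s _.
have := (rhof s).2; under eq_bigr do rewrite -[rho s _]mulr1.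
by move=> ->; rewrite mulr1.
Qed.

(** The weight [nu s] cancels. Conditional probabilities of D therefore agree under uniform and test
    settings, which lets a bound on [max_condD] at uniform settings control the PEF condition with
    the test bit. *)
Lemma condD_rtimes (R : realType) (C D S : finType) (dof : C -> D)
    (rho : S -> C -> R) (nu : S -> R) d s :
  is_family rho -> nu s != 0 ->
  condD dof (rtimes rho nu) d s = \sum_(c | dof c == d) rho s c.
Proof.
move=> rhof nus; rewrite /condD /probDS (prob_rtimes rho nu (fun c => dof c == d)).
have -> : prob (rtimes rho nu) (fun cs => cs.2 == s) = nu s.
  by have := prob_rtimes rho nu predT s; rewrite (rhof s).2 mulr1.
by rewrite mulrAC divff// mul1r.
Qed.

(** Summing out the outcomes trial by trial leaves the settings weights, since each [rho s] has mass
    1. With [entropy_iid] this makes the total input entropy additive. *)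
Lemma settings_dist_iid (R : realType) (n : nat) (C S : finType)
    (rho : S -> C -> R) (nu : S -> R) (mu : {ffun 'I_n -> C * S} -> R) :
  is_family rho -> iid_trials (rtimes rho nu) mu ->
  iid_trials nu (settings_dist mu).
Proof.
move=> rhof muE s; rewrite /settings_dist /prob.
transitivity (\prod_i \sum_(w | w.2 == s i) rtimes rho nu w); last first.
  apply: eq_bigr => i _.
  by have := prob_rtimes rho nu predT (s i); rewrite (rhof _).2 mulr1.
rewrite bigA_distr_big_dep; apply: eq_big => [x|x _]; last exact: muE.
by apply/forallP/familyP.
Qed.

(** The pair [(dof c, s)] has positive probability and so takes part in the maximum. The upper bound
    serves the PEF condition; strict positivity forces the mean of B to stay below 1. *)
Lemma condD_gt0_le (R : realType) (C D S : finType) (dof : C -> D)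
    (rho : S -> C -> R) (nu : S -> R) s c :
  is_family rho -> 0 < nu s -> 0 < rho s c ->
  0 < \sum_(c' | dof c' == dof c) rho s c' <= max_condD dof (rtimes rho nu).
Proof.
move=> rhof nus rsc.
have sum0 : 0 < \sum_(c' | dof c' == dof c) rho s c'.
  rewrite (bigD1 c)//= ltr_wpDr// sumr_ge0// => c' _; exact: (rhof s).1.
rewrite sum0 -(condD_rtimes dof (dof c) rhof (lt0r_neq0 nus)).
have pos : 0 < probDS dof (rtimes rho nu) (dof c) s.
  by rewrite /probDS (prob_rtimes rho nu (fun c' => dof c' == dof c)) mulr_gt0.
exact: (@le_bigmax_cond _ _ _ 0 (dof c, s)
  (fun ds => 0 < probDS dof (rtimes rho nu) ds.1 ds.2)
  (fun ds => condD dof (rtimes rho nu) ds.1 ds.2)).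
Qed.

(** * The settings distribution with test bit *)

Lemma sum_pair_bool (R : realType) (Z : finType) (f : Z * bool -> R) :
  \sum_zt f zt = \sum_z f (z, true) + \sum_z f (z, false).
Proof.
transitivity (\sum_z \sum_b f (z, b)).
  by rewrite pair_bigA; apply: eq_bigr => -[].
by rewrite -big_split; apply: eq_bigr => z _; rewrite big_bool.
Qed.

Lemma sum_uniform (R : realType) (Z : finType) (z0 : Z) :
  \sum_z @uniform_dist R Z z = 1 :> R.
Proof.
rewrite /uniform_dist sumr_const -[LHS]mulr_natl mulfV// pnatr_eq0 -lt0n.
by apply/card_gt0P; exists z0.
Qed.

Lemma uniform_gt0 (R : realType) (Z : finType) (z : Z) : 0 < @uniform_dist R Z z.
Proof. by rewrite invr_gt0 ltr0n; apply/card_gt0P; exists z. Qed.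

Lemma is_dist_nu_test (R : realType) (Z : finType) (z0 : Z) (r : R) :
  0 < r -> r < 1 -> is_dist (nu_test z0 r).
Proof.
move=> r0 r1; split=> [[z []]|].
- by rewrite /nu_test/= mulr_ge0 ?invr_ge0// ltW.
- by rewrite /nu_test/=; case: ifP => // _; rewrite subr_ge0 ltW.
rewrite sum_pair_bool /nu_test/= -mulr_sumr (sum_uniform R z0) -big_mkcond/=.
by rewrite big_pred1_eq mulr1 addrC subrK.
Qed.

Lemma expect_test (R : realType) (C Z : finType) (z0 : Z) (rho : Z -> C -> R)
    (r : R) (f : C * (Z * bool) -> R) :
  expect (rtimes (lift_test rho) (nu_test z0 r)) f =
  r * expect (rtimes rho (@uniform_dist R Z)) (fun cz => f (cz.1, (cz.2, true)))
  + (1 - r) * \sum_c rho z0 c * f (c, (z0, false)).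
Proof.
rewrite !expect_rtimes sum_pair_bool; congr (_ + _).
  by rewrite mulr_sumr; apply: eq_bigr => z _; rewrite mulrA.
rewrite (bigD1 z0)//= [X in _ + X]big1 => [|z /negbTE z0z].
  by rewrite /nu_test/= eqxx addr0.
by rewrite /nu_test/= z0z mul0r.
Qed.

(** The division by [r] in [B_test] compensates for the probability [r] of a test, and given a test
    the settings are uniform. *)
Lemma expect_B_test (R : realType) (C Z : finType) (z0 : Z) (rho : Z -> C -> R)
    (r : R) (B : C * Z -> R) :
  r != 0 ->
  expect (rtimes (lift_test rho) (nu_test z0 r)) (B_test B r) =
  expect (rtimes rho (@uniform_dist R Z)) B.
Proof.
move=> r0; rewrite expect_test /B_test/= [X in (1 - r) * X]big1 => [|c _]; last first.
  by rewrite mulr0.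
rewrite mulr0 addr0 -expectZ; apply: eq_bigr => -[c z] _ /=.
by field.
Qed.

(** * The PEF property *)

(** The increment y for which [F_test] is (1 - bbar)^(-beta) (1 + y). *)
Definition test_gain (R : realType) (C Z : finType) (B : C * Z -> R)
    (bbar r beta : R) (czt : C * (Z * bool)) : R :=
  beta * ((B_test B r czt - bbar) / (1 - bbar)).

Lemma expect_test_gain (R : realType) (C Z : finType) (z0 : Z)
    (rho : Z -> C -> R) (B : C * Z -> R) (bbar r beta : R) :
  is_family rho -> 0 < r -> r < 1 ->
  expect (rtimes (lift_test rho) (nu_test z0 r)) (test_gain B bbar r beta) =
  beta * ((expect (rtimes rho (@uniform_dist R Z)) B - bbar) / (1 - bbar)).
Proof.
move=> rhof r0 r1; rewrite /test_gain expectZ; congr (_ * _).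
under [X in expect _ X]eq_fun do rewrite mulrC.
rewrite expectZ mulrC; congr (_ * _).
rewrite expectD expect_B_test ?gt_eqF// expect_cst//.
by apply: is_dist_rtimes => [zt|]; [exact: rhof|exact: is_dist_nu_test].
Qed.

(** Every relevant conditional probability of D is at most 1 - b, so the factor (1 - b)^beta leaves
    the expectation, and what remains is affine in the mean of [B_test], which is b. *)
Lemma F_test_PEF (R : realType) (C D Z : finType) (dof : C -> D) (z0 : Z)
    (A : set (Z -> C -> R)) (B : C * Z -> R) (bbar r beta : R) :
  (forall rho, A rho -> is_family rho) ->
  (forall nu, rtimes_set A (@uniform_dist R Z) nu ->
     max_condD dof nu <= 1 - expect nu B) ->
  bbar < 1 -> 0 < r -> r < 1 -> 0 < beta ->
  (forall czt, 0 <= F_test B bbar r beta czt) ->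
  is_PEF dof beta (rtimes_set (lift_test_set A) (nu_test z0 r))
    (F_test B bbar r beta).
Proof.
move=> Af AB b1 r0 r1 beta0 F0; split=> //.
move=> _ [_ [rho Arho <-] <-]; have rhof := Af _ Arho.
set b := expect (rtimes rho (@uniform_dist R Z)) B.
have max_b : max_condD dof (rtimes rho (@uniform_dist R Z)) <= 1 - b.
  by apply: AB; exists rho.
have lrhof : is_family (lift_test rho) by move=> zt; exact: rhof.
have sdist := is_dist_rtimes lrhof (is_dist_nu_test z0 r0 r1).
have [c0 rc0] := is_dist_exists_gt0 (rhof z0).
have b_lt1 : 0 < 1 - b.
  have /andP[h1 h2] := condD_gt0_le dof rhof (uniform_gt0 R z0) rc0.
  exact: lt_le_trans h1 (le_trans h2 max_b).
apply: (@le_trans _ _ (expect (rtimes (lift_test rho) (nu_test z0 r))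
    (fun czt => (1 - b) `^ beta * F_test B bbar r beta czt))).
  apply: ler_expect; first exact: sdist.1.
  move=> [c zt] /= scs; rewrite mulrC ler_wpM2r//.
  have [nu0 rho0] : 0 < nu_test z0 r zt /\ 0 < rho zt.1 c.
    have h1 := (is_dist_nu_test z0 r0 r1).1 zt; have h2 := (rhof zt.1).1 c.
    move: scs; rewrite /rtimes/= /lift_test !lt0r h1 h2 mulf_eq0 negb_or.
    by move=> /andP[/andP[-> ->]].
  rewrite condD_rtimes ?gt_eqF//.
  (* Uniform settings give every z positive weight, so the bound 1 - b applies whatever the test bit
     is. *)
  have /andP[h1 h2] := condD_gt0_le dof rhof (uniform_gt0 R zt.1) rho0.
  apply: ge0_ler_powR; rewrite ?nnegrE ?(ltW beta0) ?(ltW b_lt1)//.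
    exact: ltW.
  exact: le_trans h2 max_b.
rewrite expectZ.
have -> : expect (rtimes (lift_test rho) (nu_test z0 r)) (F_test B bbar r beta)
    = (1 - bbar) `^ (- beta) * (1 + beta * ((b - bbar) / (1 - bbar))).
  rewrite expectZ expectD expect_cst//.
  by rewrite (expect_test_gain z0 B bbar beta rhof r0 r1).
set x := (b - bbar) / (1 - bbar).
have bb0 : 0 < 1 - bbar by rewrite subr_gt0.
have bE : 1 - b = (1 - bbar) * (1 - x) by rewrite /x; field; rewrite gt_eqF.
have x1 : 0 < 1 - x by rewrite bE pmulr_rgt0 in b_lt1.
(* After 1 + u <= e^u at u = beta x, taking logarithms leaves beta (ln (1 - x) + x) <= 0. *)
apply: (@le_trans _ _ ((1 - b) `^ beta * ((1 - bbar) `^ (- beta) * expR (beta * x)))).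
  by rewrite !ler_wpM2l ?powR_ge0// expR_ge1Dx.
rewrite /powR !gt_eqF// -!expRD -[leRHS]expR0 ler_expR bE lnM ?posrE//.
have : ln (1 + - x) <= - x by apply: le_ln1Dx; rewrite ltrNr opprK -subr_gt0.
rewrite -(ler_pM2l beta0) => h; lra.
Qed.

(** * Bounds on the gain and on the log-prob rate *)

(** With beta = c r, the factor r cancels the division by r in [B_test] when T = 1, and it survives
    when T = 0, where [B_test] vanishes. *)
Lemma test_gain_le (R : realType) (C Z : finType) (B : C * Z -> R)
    (bmax bbar r c : R) (czt : C * (Z * bool)) :
  (forall cz, `|B cz| <= bmax) -> 0 <= bbar -> bbar < 1 -> 0 < r -> r < 1 ->
  0 <= c ->
  `|test_gain B bbar r (c * r) czt| <=
    (if czt.2.2 then 1 else r) * (c * ((bmax + bbar) / (1 - bbar))).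
Proof.
move=> Bm b0 b1 r0 r1 c0; case: czt => a [z t].
have bb0 : 0 < 1 - bbar by rewrite subr_gt0.
have h := Bm (a, z); have h0 := normr_ge0 (B (a, z)).
rewrite /test_gain /B_test/=; case: t.
  have -> : c * r * ((B (a, z) / r - bbar) / (1 - bbar)) =
      c * ((B (a, z) - r * bbar) / (1 - bbar)) by field; rewrite !gt_eqF.
  rewrite mul1r normrM ger0_norm// ler_wpM2l// normrM.
  rewrite [`|_^-1|]gtr0_norm ?invr_gt0// ler_wpM2r ?invr_ge0 ?(ltW bb0)//.
  apply: le_trans (ler_normB _ _) _; rewrite lerD// ger0_norm ?mulr_ge0 ?(ltW r0)//.
  by rewrite ler_piMl// ltW.
rewrite sub0r mulNr mulrN normrN [leRHS]mulrA [r * c]mulrC.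
have cr0 : 0 <= c * r by rewrite mulr_ge0 // ltW.
rewrite normrM ger0_norm// ler_wpM2l//.
rewrite ger0_norm ?divr_ge0 ?(ltW bb0)//.
by rewrite ler_wpM2r ?invr_ge0 ?(ltW bb0)// lerDr (le_trans h0).
Qed.

Lemma F_test_gt0 (R : realType) (C Z : finType) (B : C * Z -> R)
    (bbar r beta : R) (czt : C * (Z * bool)) :
  bbar < 1 -> - (1 / 2) <= test_gain B bbar r beta czt ->
  0 < F_test B bbar r beta czt.
Proof.
move=> b1 h; rewrite /F_test mulr_gt0 ?powR_gt0 ?subr_gt0//.
by rewrite /test_gain in h; lra.
Qed.

(** The gain y has mean 0, so [le_lnB] loses only 2 E(y^2) <= 4 r (c M)^2. Dividing by beta = c r
    leaves 4 c M^2, free of r. *)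
Lemma logprob_rate_test_ge (R : realType) (C Z : finType) (z0 : Z)
    (rho : Z -> C -> R) (B : C * Z -> R) (bmax bbar r c : R) :
  let M := (bmax + bbar) / (1 - bbar) in
  is_family rho -> bbar = expect (rtimes rho (@uniform_dist R Z)) B ->
  (forall cz, `|B cz| <= bmax) -> 0 <= bbar -> bbar < 1 -> 0 < r -> r < 1 ->
  0 < c -> c * M <= 1 / 2 ->
  - ln (1 - bbar) - 4 * c * M ^+ 2 <=
  logprob_rate (rtimes (lift_test rho) (nu_test z0 r))
    (F_test B bbar r (c * r)) (c * r).
Proof.
move=> M rhof bE Bm b0 b1 r0 r1 c0 cM.
set sigma := rtimes _ _; pose y := test_gain B bbar r (c * r).
have cr0 : 0 < c * r by rewrite mulr_gt0.
have M0 : 0 <= c * M.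
  rewrite mulr_ge0 ?(ltW c0)// divr_ge0 ?subr_ge0 ?(ltW b1)//.
  have [a _] := is_dist_exists_gt0 (rhof z0).
  by rewrite addr_ge0// (le_trans _ (Bm (a, z0))).
have yle czt : `|y czt| <= (if czt.2.2 then 1 else r) * (c * M).
  by apply: test_gain_le => //; exact: ltW.
have y2 czt : - (1 / 2) <= y czt.
  have := yle czt; rewrite ler_norml => /andP[h _]; apply: le_trans h.
  rewrite lerN2; apply: le_trans cM; case: ifP => _; first by rewrite mul1r.
  by rewrite ler_piMl// ltW.
have sdist : is_dist sigma.
  by apply: is_dist_rtimes => [zt|]; [exact: rhof|exact: is_dist_nu_test].
(* The test branch contributes r (c M)^2 and the other one (1 - r) r^2 (c M)^2, which is no
   larger. *)
have yy : expect sigma (fun czt => y czt ^+ 2) <= 2 * r * (c * M) ^+ 2.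
  apply: (@le_trans _ _ (expect sigma (fun czt : C * (Z * bool) =>
      ((if czt.2.2 then 1 else r) * (c * M)) ^+ 2))).
    apply: ler_expect => [|czt _]; first exact: sdist.1.
    rewrite -real_normK ?num_real// lerXn2r ?nnegrE//.
    by apply: mulr_ge0 => //; case: ifP; rewrite ?(ltW r0).
  rewrite /sigma expect_test/= expect_cst; last first.
    apply: is_dist_rtimes => //; split=> [z|]; last exact: sum_uniform z0.
    exact/ltW/uniform_gt0.
  rewrite -mulr_suml (rhof z0).2 !mul1r exprMn.
  have rr : (1 - r) * r ^+ 2 <= r by nra.
  by have := ler_wpM2r (sqr_ge0 (c * M)) rr; lra.
rewrite /logprob_rate ler_pdivlMr//.
apply: (@le_trans _ _ (expect sigma (fun czt =>
    (- (c * r) * ln (1 - bbar)) + (y czt + (- 2) * y czt ^+ 2)))); last first.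
  apply: ler_expect => [|czt _]; first exact: sdist.1.
  rewrite /F_test lnM ?posrE ?powR_gt0 ?subr_gt0//; last first.
    by have := y2 czt; rewrite /y /test_gain => h; lra.
  rewrite ln_powR lerD2l mulNr; exact: le_lnB.
have y0 : expect sigma y = 0.
  by rewrite expect_test_gain// -bE subrr mul0r mulr0.
rewrite expectD expect_cst// (expectD _ y) y0 expectZ.
have -> : (- ln (1 - bbar) - 4 * c * M ^+ 2) * (c * r) =
  - (c * r) * ln (1 - bbar) - 2 * (2 * r * (c * M) ^+ 2) by ring.
lra.
Qed.

(** * Input entropy *)

(** The atom at T = 0 contributes -(1 - r) ln (1 - r) <= r, by ln u <= u - 1 at u = 1 / (1 - r). The
    equal atoms at T = 1 are computed exactly. *)
Lemma entropy_nu_test_le (R : realType) (Z : finType) (z0 : Z) (r : R) :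
  0 < r -> r < 1 ->
  entropy (nu_test z0 r) <= r * (1 + ln #|Z|%:R - ln r).
Proof.
move=> r0 r1.
have Z0 : 0 < #|Z|%:R :> R by rewrite ltr0n; apply/card_gt0P; exists z0.
rewrite /entropy sum_pair_bool /nu_test/=.
rewrite [X in _ + X](bigD1 z0)//= eqxx [X in _ + (_ + X)]big1 ?addr0; last first.
  by move=> z /negbTE->; rewrite mul0r.
rewrite sumr_const -[_ *+ _]mulr_natl -[X in X * _]/(#|Z|%:R).
have -> : ln (r / #|Z|%:R) = ln r - ln #|Z|%:R by rewrite ln_div ?posrE.
have s0 : 0 < 1 - r by rewrite subr_gt0.
have : ln ((1 - r)^-1) <= (1 - r)^-1 - 1.
  have /le_ln1Dx : -1 < (1 - r)^-1 - 1 by rewrite ltrBrDr addrC subrr invr_gt0.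
  by rewrite [1 + _]addrC subrK.
rewrite lnV ?posrE// -(ler_pM2l s0) mulrBr divff ?gt_eqF// mulr1 => h.
have -> : #|Z|%:R * (r / #|Z|%:R * (ln r - ln #|Z|%:R)) =
    r * (ln r - ln #|Z|%:R) by field; rewrite gt_eqF.
lra.
Qed.

(* With [r = A / n] the total entropy is [A * ln n + O(1)]; the factor
   [1 / (2 * A)] turns its exponential into a multiple of [sqrt n]. *)
Lemma expR_entropy_le (R : realType) (Z : finType) (z0 : Z) (A L : R) :
  0 < A -> 0 < L ->
  \forall n \near \oo,
    expR ((2 * A)^-1 * (n%:R * entropy (nu_test z0 (A / n%:R)))) <= n%:R * L.
Proof.
(* [K] is such that 1 + ln |Z| - ln (A / n) = ln (n K). The claim then reduces to n K <= (n L)^2,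
   that is, K / L^2 <= n. *)
move=> A0 L0; pose K := expR 1 * #|Z|%:R / A.
have Z0 : 0 < #|Z|%:R :> R by rewrite ltr0n; apply/card_gt0P; exists z0.
have K0 : 0 < K by rewrite divr_gt0 ?mulr_gt0 ?expR_gt0.
near=> n.
have nA : A < n%:R by near: n; exact: nbhs_infty_gtr.
have nK : K / L ^+ 2 < n%:R by near: n; exact: nbhs_infty_gtr.
have n0 : 0 < n%:R :> R by exact: lt_trans nA.
have r0 : 0 < A / n%:R by rewrite divr_gt0.
have r1 : A / n%:R < 1 by rewrite ltr_pdivrMr// mul1r.
have nL0 : 0 < n%:R * L by rewrite mulr_gt0.
rewrite -[leRHS]lnK ?posrE// ler_expR mulrC ler_pdivrMr ?mulr_gt0//.
apply: (@le_trans _ _ (A * ln (n%:R * K))); last first.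
  have -> : ln (n%:R * L) * (2 * A) = A * ln ((n%:R * L) ^+ 2).
    by rewrite lnXn// -mulr_natl; ring.
  rewrite ler_pM2l// ler_ln ?posrE ?exprn_gt0// ?(mulr_gt0 n0 K0)//.
  rewrite exprMn [_ ^+ 2]expr2 -mulrA ler_pM2l//.
  by rewrite -ler_pdivrMr ?exprn_gt0// ltW.
have -> : ln (n%:R * K) = 1 + ln #|Z|%:R - ln (A / n%:R).
  rewrite /K ln_div ?posrE// lnM ?posrE// ln_div ?posrE ?mulr_gt0 ?expR_gt0//.
  by rewrite lnM ?posrE ?expR_gt0// expRK; ring.
apply: (@le_trans _ _ (n%:R * (A / n%:R * (1 + ln #|Z|%:R - ln (A / n%:R))))).
  by rewrite ler_pM2l// entropy_nu_test_le.
by rewrite [leLHS]mulrA mulrCA divff ?mulr1// gt_eqF.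
Unshelve. all: by end_near.
Qed.

(** * Choice of the parameters and the net log-prob *)

Theorem theorem52 (R : realType) (C D Z : finType) (dof : C -> D) (z0 : Z)
    (CCZ : set (Z -> C -> R^o))
    (CCZ_family : forall rho, CCZ rho -> is_family rho)
    (CCZ_closed : pointwise_closed CCZ)
    (CCZ_convex : convex_set CCZ)
    (B : C * Z -> R)
    (B_bound : forall nu, rtimes_set CCZ (@uniform_dist R Z) nu ->
       max_condD dof nu <= 1 - expect nu B)
    (rho : Z -> C -> R) (rho_in : CCZ rho)
    (bbar : R) (bbarE : bbar = expect (rtimes rho (@uniform_dist R Z)) B)
    (bbar_gt0 : 0 < bbar)
    (epsh : R) (epsh_gt0 : 0 < epsh) (epsh_le1 : epsh <= 1) :
  let nu (r : R) := nu_test z0 r in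
  let CCZT (r : R) := rtimes_set (lift_test_set CCZ) (nu r) in
  let sigma (r : R) := rtimes (lift_test rho) (nu r) in
  let F (r beta : R) := F_test B bbar r beta in
  let g (r beta : R) := logprob_rate (sigma r) (F r beta) beta in
  exists r beta : nat -> R,
    [/\ forall n, [/\ 0 < r n, r n < 1 / 2, 0 < beta n &
          is_PEF dof (beta n) (CCZT (r n)) (F (r n) (beta n))],
        (* the logarithm of F is finite almost surely *)
        \forall n \near \oo, forall czt,
          0 < sigma (r n) czt -> 0 < F (r n) (beta n) czt,
        \forall n \near \oo, forall mu : {ffun 'I_n -> C * (Z * bool)} -> R,
          trials_model (CCZT (r n)) mu -> iid_trials (sigma (r n)) mu ->
          let gnet := expect mu
            (net_logprob (fun=> F (r n) (beta n)) (beta n) epsh) in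
          [/\ gnet = n%:R * g (r n) (beta n) - ln (epsh^-1) / beta n,
              n%:R * (- ln (1 - bbar)) / 3 <= gnet &
              entropy (settings_dist mu) = n%:R * entropy (nu (r n))] &
        exists2 a : R, 0 < a & \forall n \near \oo,
          expR (a * (n%:R * entropy (nu (r n))))
            <= n%:R * (- ln (1 - bbar)) / 3].
Proof.
move=> nu CCZT sigma F g.
have rhof := CCZ_family _ rho_in.
have bbar_lt1 : bbar < 1.
  have [c rc] := is_dist_exists_gt0 (rhof z0).
  have /andP[h1 h2] := condD_gt0_le dof rhof (uniform_gt0 R z0) rc.
  rewrite -subr_gt0 bbarE (lt_le_trans h1)// (le_trans h2)//.
  by apply: B_bound; exists rho.
pose bmax := \sum_cz `|B cz|.
have B_bmax cz : `|B cz| <= bmax by rewrite /bmax (bigD1 cz)//= lerDl sumr_ge0.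
pose M := (bmax + bbar) / (1 - bbar).
have M0 : 0 < M by rewrite divr_gt0 ?subr_gt0// ltr_wpDl// sumr_ge0.
pose L := - ln (1 - bbar).
have L0 : 0 < L.
  by rewrite oppr_gt0 ln_lt0// subr_gt0 bbar_lt1/= ltrBlDr ltrDl.
(* The first bound keeps the gain above -1/2, as [le_lnB] requires; the second limits the
   second-order loss 4 c M^2 to a third of [L]. *)
pose c := Num.min (1 / (2 * M)) (L / (12 * M ^+ 2)).
have c0 : 0 < c.
  by rewrite lt_min; apply/andP; split; apply: divr_gt0;
    rewrite // mulr_gt0// exprn_gt0.
have cM : c * M <= 1 / 2.
  have -> : 1 / 2 = 1 / (2 * M) * M by field; rewrite gt_eqF.
  by rewrite ler_pM2r// ge_min lexx.
have cM2 : 4 * c * M ^+ 2 <= L / 3.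
  have -> : L / 3 = 4 * (L / (12 * M ^+ 2)) * M ^+ 2 by field; rewrite gt_eqF.
  by rewrite ler_pM2r ?exprn_gt0// ler_pM2l// ge_min lexx orbT.
have eps0 : 0 <= ln epsh^-1 by rewrite ln_ge0// invf_ge1.
(* This caps the error term per trial, ln (1 / epsh) / (c A), at another third of [L]. The added 1
   keeps [A] positive when [epsh] is 1. *)
pose A := 3 * ln epsh^-1 / (c * L) + 1.
have A0 : 0 < A.
  by rewrite ltr_wpDl// divr_ge0 ?mulr_ge0 ?(ltW c0) ?(ltW L0).
have Aeps : ln epsh^-1 / (c * A) <= L / 3.
  rewrite ler_pdivrMr ?mulr_gt0//.
  have -> : L / 3 * (c * A) = ln epsh^-1 + L * c / 3.
    by rewrite /A; field; rewrite !gt_eqF.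
  by rewrite lerDl divr_ge0// mulr_ge0// ltW.
(* The value 1/4 for small n, n = 0 included, keeps [r n] strictly between 0 and 1/2 at every n. *)
pose r (n : nat) : R := if 4 * A < n%:R then A / n%:R else 1 / 4.
have r_bounds n : 0 < r n < 1 / 2.
  rewrite /r; case: ifP => [h|_]; last by apply/andP; split; lra.
  have n0 : 0 < n%:R :> R by lra.
  by rewrite divr_gt0// ltr_pdivrMr//=; lra.
have r_gt0 n : 0 < r n by have /andP[] := r_bounds n.
have r_lt1 n : r n < 1 by have /andP[_] := r_bounds n; lra.
have rE : \forall n \near \oo, r n = A / n%:R.
  near=> n; rewrite /r ifT//; near: n; exact: nbhs_infty_gtr.
have F_gt0 n czt : 0 < F (r n) (c * r n) czt.
  apply: F_test_gt0 => //.
  have := test_gain_le czt B_bmax (ltW bbar_gt0) bbar_lt1 (r_gt0 n) (r_lt1 n)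
    (ltW c0).
  rewrite ler_norml => /andP[h _]; apply: le_trans h; rewrite lerN2 -/M.
  apply: le_trans cM; rewrite ler_piMl ?(mulr_ge0 (ltW c0) (ltW M0))//.
  by case: (czt.2.2) => //; exact: ltW.
exists r, (fun n => c * r n); split.
- move=> n; have /andP[r0 r1] := r_bounds n; split; rewrite ?mulr_gt0//.
  apply: (F_test_PEF z0 CCZ_family B_bound bbar_lt1 r0 (r_lt1 n) (mulr_gt0 c0 r0)).
  by move=> czt; exact/ltW/F_gt0.
- by near=> n => czt _; exact: F_gt0.
- near=> n => mu _ mu_iid; set gnet := expect mu _.
  have n0 : (0 < n)%N by near: n; exact: nbhs_infty_gt.
  have nu_dist := is_dist_nu_test z0 (r_gt0 n) (r_lt1 n).
  have lrhof : is_family (lift_test rho) by move=> zt; exact: rhof.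
  have sigma_dist := is_dist_rtimes lrhof nu_dist.
  have mu_dist : is_dist mu.
    split=> [x|]; first by rewrite mu_iid prodr_ge0// => i _; exact: sigma_dist.1.
    under eq_bigr do rewrite mu_iid.
    rewrite -(bigA_distr_bigA (fun=> sigma (r n))) big1// => i _.
    exact: sigma_dist.2.
  have gnetE : gnet = n%:R * g (r n) (c * r n) - ln epsh^-1 / (c * r n).
    rewrite /gnet /net_logprob expectD expect_cst// expect_sum.
    under eq_bigr do
      rewrite (expect_iid (fun t => ln (F _ _ t) / _) _ sigma_dist mu_iid).
    rewrite sumr_const card_ord -[_ *+ n]mulr_natl /g /logprob_rate.
    by congr (_ * _ - _); under eq_fun do rewrite mulrC; rewrite expectZ mulrC.
  split=> //; last exact: entropy_iid nu_dist (settings_dist_iid lrhof mu_iid).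
  have rnE : r n = A / n%:R by near: n.
  have gle : L - 4 * c * M ^+ 2 <= g (r n) (c * r n).
    by apply: logprob_rate_test_ge => //; exact: ltW.
  have n0R : 0 < n%:R :> R by rewrite ltr0n.
  rewrite gnetE.
  (* With r = A / n the error term is linear in n, so each trial nets at least L - L/3 - L/3. *)
  have -> : ln epsh^-1 / (c * r n) = n%:R * (ln epsh^-1 / (c * A)).
    by rewrite rnE; field; rewrite !gt_eqF.
  rewrite -mulrBr -mulrA ler_pM2l// -/L; lra.
- exists (2 * A)^-1; first by rewrite invr_gt0 mulr_gt0.
  have L30 : 0 < L / 3 by rewrite divr_gt0.
  near=> n; have -> : r n = A / n%:R by near: n.
  by rewrite -mulrA; near: n; exact: expR_entropy_le.
Unshelve. all: by end_near.
Qed.
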